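(* Let $m,n\ge2$ be integers with $m$ even, and let $\mathcal{A}=(a_{j_1\cdots j_m})$ be a real $m$th order $n$-dimensional circulant tensor with diagonal entry $c_0$ and associated tensor $\bar{\mathcal{A}}_1=(\bar\alpha_{j_1\cdots j_{m-1}})$. If $$c_0\ge\sum_{j_1,\dots,j_{m-1}=1}^n|\bar\alpha_{j_1\cdots j_{m-1}}|,$$ then $\mathcal{A}$ is positive semi-definite.
   Context: Write $[n]=\{1,\dots,n\}$. A real $m$th order $n$-dimensional tensor is an array $\mathcal{A}=(a_{j_1\cdots j_m})$ of real numbers indexed by $[n]^m$. It is circulant if $a_{j_1\cdots j_m}=a_{k_1\cdots k_m}$ whenever $j_l,k_l\in[n]$ and $k_l\equiv j_l+1 \pmod n$ for all $l\in[m]$; then all diagonal entries $a_{j\cdots j}$ coincide and their common value is called the diagonal entry. The associated tensor of a circulant tensor $\mathcal{A}$ is the order $m-1$, dimension $n$ tensor with $\bar\alpha_{1\cdots1}=0$ and $\bar\alpha_{j_1\cdots j_{m-1}}=a_{1j_1\cdots j_{m-1}}$ for $(j_1,\dots,j_{m-1})\ne(1,\dots,1)$. For even $m$, $\mathcal{A}$ (not necessarily symmetric) is positive semi-definite if $\mathcal{A}\mathbf{x}^m=\sum_{j_1,\dots,j_m=1}^n a_{j_1\cdots j_m}x_{j_1}\cdots x_{j_m}\ge0$ for all $\mathbf{x}\in\mathbb{R}^n$. *)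

(* Defs.v *)
From mathcomp Require Import all_boot all_order all_algebra.
From mathcomp Require Import reals.

Set Implicit Arguments.
Unset Strict Implicit.
Unset Printing Implicit Defensive.

Import Order.TTheory GRing.Theory Num.Theory.
Local Open Scope ring_scope.

(* The index set [n] = {1, .., n} is rendered by 'I_n = {0, .., n-1}, so the
   mathematical index 1 is ord0. *)
Definition tensor (R : realType) (m n : nat) : Type := m.-tuple 'I_n -> R.

(* The relation k = j + 1 (mod n) between indices is unaffected by the shift
   from [n] to 'I_n. *)
Definition circulant (R : realType) (m n : nat) (A : tensor R m n) : Prop :=
  forall j k : m.-tuple 'I_n,
    (forall l : 'I_m, (tnth k l = (tnth j l).+1 %[mod n])%N) -> A j = A k.

Definition diag_index (m n : nat) (i : 'I_n) : m.-tuple 'I_n := nseq_tuple m i.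

(* For a circulant tensor this is the common value of all diagonal entries:
   see circulant_diag. *)
Definition diagonal_entry (R : realType) (m n : nat) (A : tensor R m n.+1) : R :=
  A (diag_index m ord0).

Definition associated_tensor (R : realType) (m n : nat)
    (A : tensor R m.+1 n.+1) : tensor R m n.+1 :=
  fun j => if j == diag_index m ord0 then 0 else A [tuple of ord0 :: j].

Definition tensor_form (R : realType) (m n : nat)
    (A : tensor R m n) (x : 'rV[R]_n) : R :=
  \sum_(j : m.-tuple 'I_n) A j * \prod_(l < m) x 0 (tnth j l).

(* Only meaningful for even m; no symmetry of A is required. *)
Definition positive_semidefinite (R : realType) (m n : nat)
    (A : tensor R m n) : Prop :=
  forall x : 'rV[R]_n, 0 <= tensor_form A x.

Lemma circulant_diag (R : realType) (m n : nat) (A : tensor R m n.+1) :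
  circulant A -> forall i : 'I_n.+1, A (diag_index m i) = diagonal_entry A.
Proof.
move=> circA [i]; elim: i => [|i IHi] lt_i.
  by congr (A (diag_index m _)); apply: val_inj.
rewrite -(IHi (ltnW lt_i)); apply/esym/circA => l.
by rewrite !tnth_nseq.
Qed.

(* Main.v *)
Require Import Defs.
From mathcomp Require Import all_boot all_order all_algebra.
From mathcomp Require Import reals.

Set Implicit Arguments.
Unset Strict Implicit.
Unset Printing Implicit Defensive.

Import Order.TTheory GRing.Theory Num.Theory.
Local Open Scope ring_scope.

(** By circulance, the entry at [(i, i + s_1, .., i + s_m)] does not depend on
    [i], so the form is [\sum_s A(0, s) P_s] with
    [P_s = \sum_i x_i x_(i + s_1) .. x_(i + s_m)]. The diagonal term [s = 0]
    contributes [c_0 \sum_i x_i ^ (m + 1)], and by AM-GM and translation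
    invariance each [|P_s|] is at most [\sum_i |x_i| ^ (m + 1)], which is the
    same power sum since [m + 1] is even. *)

(** AM-GM applied to the powers [y l ^+ N.+1], once both sides are raised to the power [N.+1]. *)
Lemma prod_le_mean_exp (R : realFieldType) (N : nat) (y : 'I_N.+1 -> R) :
  (forall l, 0 <= y l) ->
  \prod_l y l <= (\sum_l y l ^+ N.+1) / N.+1%:R.
Proof.
move=> y_ge0; rewrite -(@ler_pXn2r _ N.+1) //; last first.
- rewrite nnegrE divr_ge0 ?ler0n // sumr_ge0 // => l _; exact: exprn_ge0.
- by rewrite nnegrE prodr_ge0.
have yX_ge0 : {in predT, forall l, 0 <= y l ^+ N.+1}.
  by move=> l _; exact: exprn_ge0.
have [+ _] := leif_AGM yX_ge0.
by rewrite cardT size_enum_ord -prodrXl.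
Qed.

(** Addition in ['I_n.+1] is modulo [n.+1], so this is a simultaneous cyclic shift. *)
Definition translate (m n : nat) (i : 'I_n.+1) (s : m.-tuple 'I_n.+1) :
  m.-tuple 'I_n.+1 := map_tuple (+%R i) s.

Lemma translateK (m n : nat) (i : 'I_n.+1) :
  cancel (@translate m n i) (translate (- i)).
Proof. by move=> s; apply: eq_from_tnth => l; rewrite !tnth_map addKr. Qed.

Lemma circulant_translate (R : realType) (m n : nat) (A : tensor R m n.+1) :
  circulant A -> forall i s, A (translate i s) = A s.
Proof.
move=> circA i s.
(* Circulance is the shift by one; letting [k] range over the naturals allows iterating it by
   induction. *)
have shift k : A (map_tuple (fun a : 'I_n.+1 => inZp (k + a)) s) = A s.
  elim: k => [|k <-].
    by congr A; apply: eq_from_tnth => l; rewrite tnth_map valZpK.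
  apply/esym/circA => l; rewrite !tnth_map /= modn_mod.
  by rewrite -[in RHS]addn1 modnDml addn1.
rewrite -[RHS](shift i); congr A; apply: eq_from_tnth => l.
by rewrite !tnth_map; exact: val_inj.
Qed.

(** Each index tuple is a translate of exactly one tuple starting with [ord0]: the translation must
    be by its first entry, which is how the inverse [g] recovers it. *)
Lemma sum_cons_translate (R : realType) (m n : nat)
    (F : m.+1.-tuple 'I_n.+1 -> R) :
  \sum_t F t =
    \sum_(s : m.-tuple 'I_n.+1) \sum_i F (translate i [tuple of ord0 :: s]).
Proof.
pose h (p : m.-tuple 'I_n.+1 * 'I_n.+1) :=
  translate p.2 [tuple of ord0 :: p.1].
pose g (t : m.+1.-tuple 'I_n.+1) :=
  (translate (- thead t) [tuple of behead t], thead t).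
have hK : cancel h g.
  move=> [s i]; rewrite /g /h /=.
  have -> : thead (translate i [tuple of ord0 :: s]) = i.
    by rewrite /thead tnth_map /= (tnth_nth ord0) /= addr0.
  congr (_, _); rewrite -[RHS](translateK i); congr translate.
  exact: val_inj.
have gK : cancel g h.
  move=> t; case/tupleP: t => a t; apply: val_inj => /=.
  rewrite theadE addr0; congr (_ :: _); rewrite -map_comp.
  rewrite -[RHS]map_id; apply: eq_map => b /=; exact: addNKr.
rewrite (reindex h); last by exists g => x _.
by rewrite pair_bigA.
Qed.

Lemma sum_translate_prod_le (R : realType) (m n : nat) (x : 'rV[R]_n.+1)
    (t : m.+1.-tuple 'I_n.+1) :
  `|\sum_i \prod_(l < m.+1) x 0 (tnth (translate i t) l)|
    <= \sum_i `|x 0 i| ^+ m.+1.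
Proof.
apply: le_trans (ler_norm_sum _ _ _) _.
have amgm i : true -> `|\prod_(l < m.+1) x 0 (tnth (translate i t) l)|
    <= (\sum_(l < m.+1) `|x 0 (tnth t l + i)| ^+ m.+1) / m.+1%:R.
  move=> _; rewrite normr_prod; under eq_bigr do rewrite tnth_map addrC.
  exact: prod_le_mean_exp.
apply: le_trans (ler_sum _ amgm) _; rewrite -mulr_suml exchange_big /=.
(* For fixed [l], adding [tnth t l] permutes the indices, so all [m.+1] inner sums agree and cancel
   the division. *)
rewrite (eq_bigr (fun=> \sum_i `|x 0 i| ^+ m.+1)); last first.
  by move=> l _; rewrite [RHS](reindex_inj (addrI (tnth t l))).
by rewrite sumr_const card_ord -[X in X / _]mulr_natr mulfK // pnatr_eq0.
Qed.

(* The order is m.+1 and the dimension is n.+1. *)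
Theorem theorem5 (R : realType) (m n : nat)
    (hm : (2 <= m.+1)%N) (hn : (2 <= n.+1)%N) (m_even : ~~ odd m.+1)
    (A : tensor R m.+1 n.+1) (circA : circulant A)
    (hdiag : \sum_(j : m.-tuple 'I_n.+1) `|associated_tensor A j|
               <= diagonal_entry A) :
  positive_semidefinite A.
Proof.
move=> x; rewrite /tensor_form sum_cons_translate.
pose P (s : m.-tuple 'I_n.+1) :=
  \sum_i \prod_(l < m.+1) x 0 (tnth (translate i [tuple of ord0 :: s]) l).
pose S := \sum_i `|x 0 i| ^+ m.+1.
under eq_bigr => s _.
  under eq_bigr do rewrite (circulant_translate circA).
  rewrite -mulr_sumr -/(P s); over.
have P0 : P (diag_index m ord0) = S.
  (* Evenness of the order removes the absolute value here. *)
  apply: eq_bigr => i _; rewrite -normrX ger0_norm ?exprn_even_ge0 //.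
  rewrite (eq_bigr (fun=> x 0 i)) ?prodr_const ?card_ord // => l _.
  have -> : [tuple of ord0 :: diag_index m ord0] = diag_index m.+1 (@ord0 n).
    exact: val_inj.
  by rewrite tnth_map tnth_nseq addr0.
have S_ge0 : 0 <= S by apply: sumr_ge0 => i _; exact: exprn_ge0.
rewrite (bigD1 (diag_index m ord0)) //= P0.
have -> : A [tuple of ord0 :: diag_index m ord0] = diagonal_entry A.
  by congr A; exact: val_inj.
have : `|\sum_(s | s != diag_index m ord0) A [tuple of ord0 :: s] * P s|
    <= diagonal_entry A * S.
  apply: le_trans (ler_norm_sum _ _ _) _.
  apply: le_trans (ler_wpM2r S_ge0 hdiag); rewrite mulr_suml.
  (* The associated tensor vanishes at this index and elsewhere agrees with [A], so both sums run
     over the same coefficients. *)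
  rewrite [leRHS](bigD1 (diag_index m ord0)) //= /associated_tensor eqxx.
  rewrite normr0 mul0r add0r; apply: ler_sum => s /negPf ->.
  by rewrite normrM ler_wpM2l // sum_translate_prod_le.
by rewrite ler_norml -subr_ge0 opprK addrC => /andP[].
Qed.
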